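(* The variety of monadic ortholattices is closed under MacNeille completions and under canonical completions. That is, for every monadic ortholattice $L=(L,\wedge,\vee,{}',0,1,\exists)$: (i) the MacNeille completion $\overline{L}$, equipped with the extended operations $\overline{'}$ and $\overline{\exists}$, is a monadic ortholattice; and (ii) the canonical completion $L^\sigma$, equipped with the extended operations $'^\sigma$ and $\exists^\sigma$, is a monadic ortholattice.
   Context: An ortholattice is a bounded lattice $(L,\wedge,\vee,{}',0,1)$ with an order-inverting complementation $'$ of period two (so $a''=a$, $a\le b\Rightarrow b'\le a'$, $a\wedge a'=0$, $a\vee a'=1$). A monadic ortholattice is an ortholattice with a quantifier $\exists:L\to L$, i.e. a closure operator (order preserving, $a\le\exists a$, $\exists\exists a=\exists a$) such that the orthocomplement of each closed element ($a=\exists a$) is closed. MacNeille completion. For a bounded lattice $L$ it is a pair $(e,\overline{L})$ where $\overline L$ is a complete lattice, $e:L\to\overline L$ is a lattice embedding, and each element of $\overline L$ is both a join and a meet of elements of the image of $L$ (it is unique up to isomorphism). For a monadic ortholattice $L$, its MacNeille completion is the bounded lattice $\overline L$ with the operations $$x^{\overline{'}}=\bigwedge\{e(a'):e(a)\le x\},\qquad \overline{\exists}x=\bigvee\{e(\exists a):e(a)\le x\}.$$ Canonical completion. For a bounded lattice $L$ it is a pair $(e,C)$ where $C$ is a complete lattice and $e:L\to C$ is a bounded lattice embedding that is dense (each element of $C$ is both a join of meets and a meet of joins of elements of the image of $L$) and compact (if $S,T\subseteq L$ and $\bigwedge e[S]\le\bigvee e[T]$, then $\bigwedge e[S']\le\bigvee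 e[T']$ for some finite $S'\subseteq S$ and $T'\subseteq T$). It is unique up to isomorphism and denoted $L^\sigma$. An element of $L^\sigma$ is closed if it is a meet of elements of the image of $L$; $\mathcal{K}$ is the set of closed elements. For a monadic ortholattice $L$ the extended operations on $L^\sigma$ are $$x^{'^\sigma}=\bigwedge\{\bigvee\{e(a'):k\le e(a)\}:k\le x,\ k\in\mathcal{K}\},\qquad \exists^\sigma x=\bigvee\{\bigwedge\{e(\exists a):k\le e(a)\}:k\le x,\ k\in\mathcal{K}\}.$$ *)

(* Defs.v *)
From HB Require Import structures.
From mathcomp Require Import all_boot all_order.
From mathcomp Require Import boolp classical_sets cardinality.

Set Implicit Arguments.
Unset Strict Implicit.
Unset Printing Implicit Defensive.

Local Open Scope classical_set_scope.
Local Open Scope order_scope.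

Record ortholattice d (L : tbLatticeType d) (compl : L -> L) : Prop := {
  compl_involutive : involutive compl;
  compl_antitone : forall a b : L, a <= b -> compl b <= compl a;
  meet_compl : forall a : L, a `&` compl a = \bot;
  join_compl : forall a : L, a `|` compl a = \top }.

Record closure_operator d (L : porderType d) (f : L -> L) : Prop := {
  closure_monotone : {homo f : a b / a <= b};
  closure_extensive : forall a : L, a <= f a;
  closure_idempotent : forall a : L, f (f a) = f a }.

Record quantifier d (L : tbLatticeType d) (compl ex : L -> L) : Prop := {
  quantifier_closure : closure_operator ex;
  quantifier_compl : forall a : L, a = ex a -> compl a = ex (compl a) }.

Record monadic_ortholattice d (L : tbLatticeType d) (compl ex : L -> L)
    : Prop := {
  monadic_ortho : ortholattice compl;
  monadic_quantifier : quantifier compl ex }.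

Definition complete_lattice d (C : porderType d) : Prop :=
  forall A : set C, supremums A !=set0 /\ infimums A !=set0.

(* [supremum x0 A] returns [x0] when [A] is empty; the defaults below make the
   empty join [\bot] and the empty meet [\top]. The values are the actual joins
   and meets whenever these exist, in particular in a complete lattice. *)
Definition set_join d (C : tbLatticeType d) (A : set C) : C := supremum \bot A.
Definition set_meet d (C : tbLatticeType d) (A : set C) : C := infimum \top A.

(* The library's [{tblmorphism L -> C}] only asks for preservation of the
   bounds, not of meets and joins, hence the explicit conditions. *)
Record lattice_embedding d (L : latticeType d) d' (C : latticeType d')
    (e : L -> C) : Prop := {
  embedding_inj : injective e;
  embedding_meet : Order.meet_morphism e;
  embedding_join : Order.join_morphism e }.

Record bounded_lattice_embedding d (L : tbLatticeType d)
    d' (C : tbLatticeType d') (e : L -> C) : Prop := {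
  bounded_embedding : lattice_embedding e;
  embedding_bot : e \bot = \bot;
  embedding_top : e \top = \top }.

Section MacNeille.
Context d (L : tbLatticeType d) d' (C : tbLatticeType d') (e : L -> C).

Record macneille_completion : Prop := {
  macneille_complete : complete_lattice C;
  macneille_embedding : lattice_embedding e;
  macneille_join_dense :
    forall x : C, exists S : set L, x = set_join (e @` S);
  macneille_meet_dense :
    forall x : C, exists S : set L, x = set_meet (e @` S) }.

Definition macneille_compl (compl : L -> L) (x : C) : C :=
  set_meet [set e (compl a) | a in [set a | e a <= x]].

Definition macneille_ex (ex : L -> L) (x : C) : C :=
  set_join [set e (ex a) | a in [set a | e a <= x]].

End MacNeille.

Section Canonical.
Context d (L : tbLatticeType d) d' (C : tbLatticeType d') (e : L -> C).

Definition canonical_dense : Prop :=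
  forall x : C,
    (exists F : set (set L), x = set_join [set set_meet (e @` S) | S in F]) /\
    (exists F : set (set L), x = set_meet [set set_join (e @` S) | S in F]).

Definition canonical_compact : Prop :=
  forall S T : set L, set_meet (e @` S) <= set_join (e @` T) ->
    exists S' T' : set L,
      [/\ finite_set S', S' `<=` S, finite_set T', T' `<=` T
        & set_meet (e @` S') <= set_join (e @` T')].

Record canonical_completion : Prop := {
  canonical_complete : complete_lattice C;
  canonical_embedding : bounded_lattice_embedding e;
  canonical_is_dense : canonical_dense;
  canonical_is_compact : canonical_compact }.

Definition closed_element (k : C) : Prop :=
  exists S : set L, k = set_meet (e @` S).

Definition canonical_compl (compl : L -> L) (x : C) : C :=
  set_meet [set set_join [set e (compl a) | a in [set a | k <= e a]]
           | k in [set k | k <= x /\ closed_element k]].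

Definition canonical_ex (ex : L -> L) (x : C) : C :=
  set_join [set set_meet [set e (ex a) | a in [set a | k <= e a]]
           | k in [set k | k <= x /\ closed_element k]].

End Canonical.

(* Main.v *)
Require Import Defs.
From HB Require Import structures.
From mathcomp Require Import all_boot all_order.
From mathcomp Require Import boolp classical_sets cardinality.

(** Both completions present every element as a join of simple ones, the basis:
    the image of [L] for the MacNeille completion, the closed elements for the
    canonical one. In both cases the orthocomplement of [x] is the meet of
    prescribed orthocomplements [o i] of the basis elements [h i] below [x],
    and the quantifier of [x] is the join of prescribed values [g i]. The axioms
    then follow from a few conditions on [h], [o] and [g] alone.

    Orthogonality [h i <= o j] of basis elements is symmetric, so the
    complement is a Galois connection of [C] with its dual. It is an involution
    because the elements [o i] are its values at the [h i] and are meet-dense;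
    only [\bot] is orthogonal to itself, and De Morgan gives the rest
    ([basis_ortholattice]).

    For the quantifier [E] the condition that matters is: if [g i] is orthogonal
    to [h j], it is orthogonal to [g j]. In [L] it holds because the complement
    of a closed element is closed. It yields that the complement of each [E x]
    is a fixed point of [E]. This is the quantifier axiom, and applied twice it
    gives idempotence, since [E x] is the complement of its complement
    ([basis_monadic_ortholattice]).

    For the MacNeille completion the conditions are statements about [L]. For
    the canonical completion, compactness reduces them to [L]: an inequality
    between a down-directed meet and an up-directed join of image elements is
    witnessed by an inequality between two members ([directed_compact]), so two
    closed elements are orthogonal exactly when they lie below orthogonal
    elements of [L] ([le_closed_complP]). *)

Set Implicit Arguments.
Unset Strict Implicit.
Unset Printing Implicit Defensive.

Import Order.TTheory.
Local Open Scope classical_set_scope.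
Local Open Scope order_scope.

(** * Joins and meets in a complete lattice *)

Section Complete.
Context d (C : tbLatticeType d) (hC : complete_lattice C).

Lemma set_join_leP (A : set C) (y : C) :
  set_join A <= y <-> forall a, A a -> a <= y.
Proof.
rewrite /set_join /supremum; case: ifPn => [/eqP ->|_].
  by split=> // _; rewrite le0x.
have [ub lub] := xgetPex \bot (hC A).1.
by split=> [le_y a /ub le_a|/lub//]; apply: le_trans le_y.
Qed.

Lemma le_set_meetP (A : set C) (y : C) :
  y <= set_meet A <-> forall a, A a -> y <= a.
Proof.
rewrite /set_meet /infimum; case: ifPn => [/eqP ->|_].
  by split=> // _; rewrite lex1.
have [lb glb] := xgetPex \top (hC A).2.
by split=> [le_y a /lb|/glb//]; apply: le_trans le_y.
Qed.

Lemma le_set_join (A : set C) (a : C) : A a -> a <= set_join A.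
Proof. by move=> Aa; apply: (set_join_leP A _).1 Aa. Qed.

Lemma set_meet_le (A : set C) (a : C) : A a -> set_meet A <= a.
Proof. by move=> Aa; apply: (le_set_meetP A _).1 Aa. Qed.

End Complete.

Lemma embedding_le d (L : latticeType d) d' (C : latticeType d') (e : L -> C) :
  lattice_embedding e -> forall a b, (e a <= e b) = (a <= b).
Proof.
move=> he a b; rewrite !leEmeet -(embedding_meet he).
exact: (inj_eq (embedding_inj he)).
Qed.

(** * Monadic ortholattices *)

Lemma compl_swap d (L : tbLatticeType d) (compl : L -> L) :
  ortholattice compl -> forall a b, a <= compl b -> b <= compl a.
Proof.
by move=> hL a b /(compl_antitone hL); rewrite (compl_involutive hL).
Qed.

(** The complement of [ex a] is closed, so it lies above [ex b] as soon as it
    lies above [b]. *)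
Lemma compl_orthogonal_ex d (L : tbLatticeType d) (compl ex : L -> L) :
  monadic_ortholattice compl ex ->
  forall a b, ex a <= compl b -> ex a <= compl (ex b).
Proof.
move=> [hL [hex hcl]] a b /(compl_swap hL) le_b; apply: (compl_swap hL).
rewrite [leRHS]hcl ?(closure_idempotent hex) //.
exact: closure_monotone.
Qed.

Section Basis.
Context d (C : tbLatticeType d) (I : Type) (h o g : I -> C) (f E : C -> C).
Hypothesis h_dense :
  forall x z, (forall i, h i <= x -> h i <= z) -> x <= z.
Hypothesis o_dense :
  forall x z, (forall i, x <= o i -> z <= o i) -> z <= x.
Hypothesis o_sym : forall i j, h i <= o j -> h j <= o i.
Hypothesis o_irrefl : forall i, h i <= o i -> h i <= \bot.
Hypothesis fP : forall x z, z <= f x <-> forall i, h i <= x -> z <= o i.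

(** [h j <= o i] says that [h j] and [h i] are orthogonal; [x <= f y] says that
    every basis element below [x] is orthogonal to every one below [y]. *)
Lemma basis_compl_swap x y : x <= f y -> y <= f x.
Proof.
move=> le_xf; apply/fP => i le_ix; apply: h_dense => j le_jy.
by apply: o_sym; apply: (fP y _).1 le_jy; apply: le_trans le_xf.
Qed.

Lemma basis_compl_antitone x y : x <= y -> f y <= f x.
Proof.
move=> le_xy; apply: basis_compl_swap; apply: (le_trans le_xy).
exact: basis_compl_swap.
Qed.

Lemma basis_compl_h i : f (h i) = o i.
Proof.
apply/le_anti/andP; split; first exact: (fP (h i) _).1.
apply/fP => j le_ji; apply: h_dense => k /o_sym le_ik.
apply: o_sym; exact: le_trans le_ik.
Qed.

Lemma basis_compl_involutive : involutive f.
Proof.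
move=> x; apply/le_anti/andP; split; last exact: basis_compl_swap.
apply: o_dense => i; rewrite -basis_compl_h => le_x.
by apply: basis_compl_antitone; apply: basis_compl_swap.
Qed.

Lemma basis_ortholattice : ortholattice f.
Proof.
have meet0 x : x `&` f x = \bot.
  apply/le_anti; rewrite le0x andbT; apply: h_dense => i.
  rewrite lexI => /andP[le_ix le_if]; apply: o_irrefl.
  exact: (fP x _).1 le_ix.
split=> //; first exact: basis_compl_involutive.
  exact: basis_compl_antitone.
move=> x; apply/le_anti; rewrite lex1 /=.
(* De Morgan: the complement of the join lies below both [f x] and [x]. *)
rewrite -[leRHS]basis_compl_involutive; apply: basis_compl_swap.
apply: (@le_trans _ _ \bot); last exact: le0x.
rewrite -(meet0 x) lexI -[X in _ <= X]basis_compl_involutive.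
by rewrite !basis_compl_antitone ?leUl ?leUr.
Qed.

Hypothesis h_le_g : forall i, h i <= g i.
Hypothesis g_orth : forall i j, g i <= o j -> g i <= f (g j).
Hypothesis EP : forall x y, E x <= y <-> forall i, h i <= x -> g i <= y.

Lemma basis_ex_extensive x : x <= E x.
Proof.
apply: h_dense => i le_ix; apply: (le_trans (h_le_g i)).
exact: (EP x _).1 le_ix.
Qed.

(** If [h j] is orthogonal to [E x], it is orthogonal to all the [g i] whose
    join is [E x]; so [g j] is orthogonal to each of them, hence to [E x]. *)
Lemma basis_ex_compl_ex x : E (f (E x)) = f (E x).
Proof.
apply/le_anti; rewrite basis_ex_extensive andbT; apply/EP => j.
move=> /basis_compl_swap/EP le_E; apply: basis_compl_swap.
by apply/EP => i /le_E; rewrite basis_compl_h => /g_orth.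
Qed.

Lemma basis_monadic_ortholattice : monadic_ortholattice f E.
Proof.
split; first exact: basis_ortholattice.
split=> [|x x_closed]; last by rewrite x_closed basis_ex_compl_ex.
split=> [x y le_xy||x]; last 2 first.
- exact: basis_ex_extensive.
(* [E x] is the complement of [f (E x)], which is a fixed point of [E]. *)
- rewrite -[X in E X]basis_compl_involutive -(basis_ex_compl_ex x).
  by rewrite basis_ex_compl_ex basis_ex_compl_ex basis_compl_involutive.
by apply/EP => i le_ix; apply: (EP y _).1 (le_trans le_ix le_xy).
Qed.

End Basis.

(** * MacNeille completions *)

Lemma macneille_monadic_ortholattice d (L : tbLatticeType d)
    (compl ex : L -> L) d' (C : tbLatticeType d') (e : L -> C) :
  monadic_ortholattice compl ex -> macneille_completion e ->
  monadic_ortholattice (macneille_compl e compl) (macneille_ex e ex).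
Proof.
move=> hL [hC he jd md].
have [ho [hex _]] := hL.
have eE := embedding_le he.
have fP x z : z <= macneille_compl e compl x <->
    forall a, e a <= x -> z <= e (compl a).
  rewrite (le_set_meetP hC); split=> [le_z a le_a|le_z _ [a le_a <-]].
    by apply: le_z; exists a.
  exact: le_z.
apply: (basis_monadic_ortholattice (h := e) (o := e \o compl) (g := e \o ex))
  => //=.
- move=> x z le_z; have [S def_x] := jd x; rewrite def_x in le_z *.
  apply/(set_join_leP hC) => _ [a Sa <-]; apply: le_z.
  by apply: (le_set_join hC); exists a.
- move=> x z le_z; have [S def_x] := md x; rewrite def_x in le_z *.
  apply/(le_set_meetP hC) => _ [a Sa <-].
  rewrite -[a](compl_involutive ho); apply: le_z.
  by rewrite (compl_involutive ho); apply: (set_meet_le hC); exists a.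
- by move=> a b; rewrite !eE; apply: compl_swap.
- move=> a; rewrite eE => le_a.
  (* [e \bot] is below every meet of image elements, hence is [\bot]. *)
  have [S ->] := md \bot; apply/(le_set_meetP hC) => _ [b _ <-].
  rewrite eE; apply: (@le_trans _ _ \bot); last exact: le0x.
  by rewrite -(meet_compl ho a) lexI lexx.
- by move=> a; rewrite eE closure_extensive.
- move=> a b; rewrite eE => /(compl_orthogonal_ex hL) le_ab.
  apply/fP => c; rewrite !eE => le_cb.
  by apply: (le_trans le_ab); apply: (compl_antitone ho).
move=> x y; rewrite (set_join_leP hC); split=> [le_y a le_a|le_y _ [a le_a <-]].
  by apply: le_y; exists a.
exact: le_y.
Qed.

(** * Canonical completions *)

(** Directed sets rather than filters and ideals: the image of a filter under
    a quantifier is down-directed but need not be a filter. *)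
Definition directed T (r : rel T) (S : set T) :=
  S !=set0 /\ forall a b, S a -> S b -> exists c, [/\ S c, r a c & r b c].

Lemma directed_finite_bound (T : eqType) (r : rel T) (S A : set T) :
  transitive r -> directed r S -> finite_set A -> A `<=` S ->
  exists2 c, S c & forall a, A a -> r a c.
Proof.
move=> r_trans [[c0 Sc0] dirS] /finite_seqP[s ->]; elim: s => [|a s IHs] sub_sS.
  by exists c0.
have [|c Sc cP] := IHs.
  by move=> b sb; apply: sub_sS; rewrite /= inE sb orbT.
have [|b [Sb rab rcb]] := dirS a c _ Sc.
  by apply: sub_sS; rewrite /= mem_head.
exists b => // x; rewrite /= inE => /predU1P[->//|/cP rxc].
exact: r_trans rcb.
Qed.

Lemma directed_image T T' (r : rel T) (r' : rel T') (f : T -> T')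
    (S : set T) :
  {homo f : a b / r a b >-> r' a b} -> directed r S -> directed r' (f @` S).
Proof.
move=> f_homo [[a0 Sa0] dirS]; split; first by exists (f a0), a0.
move=> _ _ [a Sa <-] [b Sb <-]; have [c [Sc rac rbc]] := dirS a b Sa Sb.
by exists (f c); split; [exists c | apply: f_homo | apply: f_homo].
Qed.

Section Canonical.
Context d (L : tbLatticeType d) d' (C : tbLatticeType d') (e : L -> C).
Hypothesis he : canonical_completion e.

Let hC := canonical_complete he.
Let eE := embedding_le (bounded_embedding (canonical_embedding he)).

(** Directedness replaces the two finite subsets given by compactness by one
    element each, a lower bound in [S] and an upper bound in [T]. *)
Lemma directed_compact (S T : set L) :
  directed >=%O S -> directed <=%O T ->
  set_meet (e @` S) <= set_join (e @` T) ->
  exists s t, [/\ S s, T t & s <= t].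
Proof.
move=> dirS dirT /(canonical_is_compact he)[S' [T' [finS subS finT subT le_ST]]].
have ge_trans : transitive (>=%O : rel L).
  by move=> b a c /= le_ba le_cb; apply: le_trans le_cb le_ba.
have [s Ss sP] := directed_finite_bound ge_trans dirS finS subS.
have [t Tt tP] := directed_finite_bound le_trans dirT finT subT.
exists s, t; split=> //; rewrite -eE; apply: le_trans (le_trans le_ST _).
  by apply/(le_set_meetP hC) => _ [a /sP le_sa <-]; rewrite eE.
by apply/(set_join_leP hC) => _ [a /tP le_at <-]; rewrite eE.
Qed.

Lemma closed_elementE (k : C) :
  closed_element e k -> k = set_meet (e @` [set a | k <= e a]).
Proof.
move=> [S def_k]; apply/le_anti/andP; split.
  by apply/(le_set_meetP hC) => _ [a le_ka <-].
rewrite {2}def_k; apply/(le_set_meetP hC) => _ [a Sa <-].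
apply: (set_meet_le hC); exists a => //=.
by rewrite def_k; apply: (set_meet_le hC); exists a.
Qed.

Lemma above_directed (k : C) : directed >=%O [set a | k <= e a].
Proof.
split; first by exists \top; rewrite /= (embedding_top (canonical_embedding he)) lex1.
move=> a b /= le_ka le_kb; exists (a `&` b); rewrite leIl leIr; split=> //=.
by rewrite (embedding_meet (bounded_embedding (canonical_embedding he))) lexI le_ka.
Qed.

Lemma closed_dense (x z : C) :
  (forall k, closed_element e k -> k <= x -> k <= z) -> x <= z.
Proof.
move=> le_z; have [[F def_x] _] := canonical_is_dense he x.
rewrite def_x; apply/(set_join_leP hC) => _ [S FS <-]; apply: le_z.
  by exists S.
by rewrite def_x; apply: (le_set_join hC); exists S.
Qed.

Lemma open_dense (x z : C) :
  (forall S, x <= set_join (e @` S) -> z <= set_join (e @` S)) -> z <= x.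
Proof.
move=> le_z; have [_ [F def_x]] := canonical_is_dense he x.
rewrite def_x; apply/(le_set_meetP hC) => _ [S FS <-]; apply: le_z.
by rewrite def_x; apply: (set_meet_le hC); exists S.
Qed.

Section Operations.
Context (compl ex : L -> L) (hL : monadic_ortholattice compl ex).

Let ho := monadic_ortho hL.
Let hex := quantifier_closure (monadic_quantifier hL).

Definition closed_compl (k : C) : C :=
  set_join [set e (compl a) | a in [set a | k <= e a]].

Definition closed_ex (k : C) : C :=
  set_meet [set e (ex a) | a in [set a | k <= e a]].

Lemma le_closed_compl (k : C) (a : L) :
  k <= e a -> e (compl a) <= closed_compl k.
Proof. by move=> le_ka; apply: (le_set_join hC); exists a. Qed.

Lemma compl_above_directed (k : C) :
  directed <=%O (compl @` [set a | k <= e a]).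
Proof.
apply: directed_image (above_directed k) => a b /=.
exact: compl_antitone.
Qed.

Lemma directed_le_closed_compl (S : set L) (k : C) :
  directed >=%O S -> set_meet (e @` S) <= closed_compl k ->
  exists s c, [/\ S s, k <= e c & s <= compl c].
Proof.
move=> dirS; rewrite /closed_compl -(image_comp compl e).
case/(directed_compact dirS (compl_above_directed k)) => s [_ [Ss [c le_kc <-] le_s]].
by exists s, c.
Qed.

(** Orthogonality of closed elements in terms of [L], where it is visibly
    symmetric in [k] and [l]. *)
Lemma le_closed_complP (k l : C) : closed_element e k ->
  k <= closed_compl l <-> exists a b, [/\ k <= e a, l <= e b & a <= compl b].
Proof.
move=> /closed_elementE def_k; split.
  rewrite {1}def_k => /(directed_le_closed_compl (above_directed k)).
  by move=> [a [b [? ? ?]]]; exists a, b.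
move=> [a [b [le_ka le_lb le_ab]]]; apply: (le_trans le_ka).
by apply: le_trans (le_closed_compl le_lb); rewrite eE.
Qed.

Lemma closed_ex_extensive (k : C) : k <= closed_ex k.
Proof.
apply/(le_set_meetP hC) => _ [a le_ka <-]; apply: (le_trans le_ka).
by rewrite eE (closure_extensive hex).
Qed.

(** Compactness gives [a] above [k] and [b] above [l] with [ex a] orthogonal
    to [b], hence to [ex b], which lies above [closed_ex l]. *)
Lemma closed_ex_orthogonal (k l m : C) :
  closed_ex k <= closed_compl l -> m <= closed_ex l ->
  closed_ex k <= closed_compl m.
Proof.
rewrite {1}/closed_ex -(image_comp ex e) => le_kl le_ml.
have dir_ex : directed >=%O (ex @` [set a | k <= e a]).
  apply: directed_image (above_directed k) => a b /=.
  exact: (closure_monotone hex).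
have [_ [b [[a le_ka <-] le_lb le_ab]]] := directed_le_closed_compl dir_ex le_kl.
apply: (@le_trans _ _ (e (ex a))).
  by apply: (set_meet_le hC); exists a.
apply: (@le_trans _ _ (e (compl (ex b)))).
  by rewrite eE (compl_orthogonal_ex hL).
apply: le_closed_compl; apply: (le_trans le_ml).
by apply: (set_meet_le hC); exists b.
Qed.

(** The complements of closed elements are thus the joins of image elements,
    hence meet-dense. The closed element is the meet of the [e (compl a)] for
    all [a] below the join, not only those in [S], so that the meet is
    directed. *)
Lemma closed_compl_open (S : set L) :
  exists2 k, closed_element e k & closed_compl k = set_join (e @` S).
Proof.
pose D := [set a | e a <= set_join (e @` S)].
have dirD : directed >=%O (compl @` D).
  apply: (directed_image (r := <=%O)) => [a b /=|]; first exact: compl_antitone.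
  split=> [|a b /= le_a le_b].
    by exists \bot; rewrite /D /= (embedding_bot (canonical_embedding he)) le0x.
  exists (a `|` b); rewrite leUl leUr /D; split=> //=.
  by rewrite (embedding_join (bounded_embedding (canonical_embedding he))) leUx le_a.
exists (set_meet (e @` (compl @` D))); first by exists (compl @` D).
apply/le_anti/andP; split; apply/(set_join_leP hC) => _ [a + <-].
- move=> /= le_a.
  have dir_a : directed <=%O [set b | b <= a].
    split; first by exists a; rewrite /=.
    by move=> b c /= le_b le_c; exists a.
  have [] := directed_compact dirD dir_a.
    by apply: (le_trans le_a); apply: (le_set_join hC); exists a => /=.
  move=> _ [b [[s Ds <-] /= le_ba le_sb]]; apply: le_trans Ds.
  rewrite eE -[leRHS](compl_involutive ho); apply: (compl_antitone ho).
  exact: le_trans le_ba.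
- move=> Sa; rewrite -[a](compl_involutive ho); apply: le_closed_compl.
  apply: (set_meet_le hC); exists (compl a) => //; exists a => //.
  by apply: (le_set_join hC); exists a.
Qed.

Lemma canonical_monadic_ortholattice :
  monadic_ortholattice (canonical_compl e compl) (canonical_ex e ex).
Proof.
pose h (i : {k | closed_element e k}) := sval i.
have fP x z : z <= canonical_compl e compl x <->
    forall i, h i <= x -> z <= closed_compl (h i).
  rewrite (le_set_meetP hC); split=> [le_z [k k_cl] le_k|le_z _ [k [le_k k_cl] <-]].
    by apply: le_z; exists k.
  exact: (le_z (exist _ k k_cl)).
apply: (basis_monadic_ortholattice (h := h) (o := closed_compl \o h)
  (g := closed_ex \o h)) => //=.
- move=> x z le_z; apply: closed_dense => k k_cl.
  exact: (le_z (exist _ k k_cl)).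
- move=> x z le_z; apply: open_dense => S.
  have [k k_cl <-] := closed_compl_open S.
  exact: (le_z (exist _ k k_cl)).
- move=> [k k_cl] [l l_cl] /= /(le_closed_complP _ k_cl)[a [b [le_ka le_lb le_ab]]].
  apply/(le_closed_complP _ l_cl); exists b, a; split=> //.
  exact: compl_swap le_ab.
- move=> [k k_cl] /= /(le_closed_complP _ k_cl)[a [b [le_ka le_kb le_ab]]].
  have <- := embedding_bot (canonical_embedding he).
  rewrite -(meet_compl ho b).
  rewrite (embedding_meet (bounded_embedding (canonical_embedding he))) lexI le_kb /=.
  by apply: (le_trans le_ka); rewrite eE.
- by move=> i; apply: closed_ex_extensive.
- move=> i j le_ij; apply/fP => m le_mj.
  exact: closed_ex_orthogonal le_ij le_mj.
move=> x y; rewrite (set_join_leP hC); split=> [le_y [k k_cl] le_k|le_y _ [k [le_k k_cl] <-]].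
  by apply: le_y; exists k.
exact: (le_y (exist _ k k_cl)).
Qed.

End Operations.
End Canonical.

Theorem mainTheorem1 (d : Order.disp_t) (L : tbLatticeType d)
    (compl ex : L -> L) (hL : monadic_ortholattice compl ex) :
  (forall (d' : Order.disp_t) (C : tbLatticeType d') (e : L -> C),
      macneille_completion e ->
      monadic_ortholattice (macneille_compl e compl) (macneille_ex e ex)) /\
  (forall (d' : Order.disp_t) (C : tbLatticeType d') (e : L -> C),
      canonical_completion e ->
      monadic_ortholattice (canonical_compl e compl) (canonical_ex e ex)).
Proof.
split=> d' C e he; first exact: macneille_monadic_ortholattice.
exact: canonical_monadic_ortholattice.
Qed.
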